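(* Let $(Q,\leq,\cdot,\rightarrow,0,1)$ be a bounded commutative residuated monoid and let $a_0\in Q$. Let $(Q^2,\leq)$ be the full twist product of $(Q,\leq)$, and define operators $\odot$ and $\Rightarrow$ (mappings from $Q^2\times Q^2$ to the power set of $Q^2$) by \begin{align*} (x,y)\odot(z,v) & :=\{(x\cdot z,\,x\rightarrow v),\,(x\cdot z,\,z\rightarrow y)\}, \\ (x,y)\Rightarrow(z,v) & :=\{(x\rightarrow z,\,x\cdot v),\,(v\rightarrow y,\,x\cdot v)\} \end{align*} for all $(x,y),(z,v)\in Q^2$. Then $(Q^2,\leq,\odot,\Rightarrow,(0,1),(1,0))$ is an operator residuated poset, and the mapping $x\mapsto(x,a_0)$ is an embedding of the poset $(Q,\leq)$ into the poset $(Q^2,\leq)$.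
   Context: A bounded commutative residuated monoid $(Q,\leq,\cdot,\rightarrow,0,1)$ is a poset $(Q,\leq)$ with least element $0$ and greatest element $1$ and with binary operations $\cdot,\rightarrow$ such that $\cdot$ is commutative and associative, $x\cdot 1=x$ for all $x\in Q$, and for all $x,y,z\in Q$: $x\cdot y\leq z$ if and only if $x\leq y\rightarrow z$. The full twist product of a poset $(Q,\leq)$ is the poset $(Q^2,\leq)$ where $(x,y)\leq(z,v)$ if and only if $x\leq z$ and $v\leq y$. For subsets $A,B$ of a poset, $A\leq B$ means $x\leq y$ for all $x\in A$ and $y\in B$; singletons are identified with their elements, so $A\leq z$ means $x\leq z$ for all $x\in A$, and $x\leq B$ means $x\leq y$ for all $y\in B$. An operator residuated poset is an ordered six-tuple $(P,\leq,\odot,\Rightarrow,0,1)$ such that: (i) $(P,\leq,0,1)$ is a bounded poset ($0$ least, $1$ greatest); (ii) $\odot$ and $\Rightarrow$ are mappings from $P^2$ to $2^P$; and for all $x,y,z\in P$: (iii) $x\odot y=y\odot x$; (iv) $\bigcup_{u\in x\odot y}(u\odot z)=\bigcup_{u\in y\odot z}(x\odot u)$; (v) $x\odot y\leq z$ if and only if $x\leq y\Rightarrow z$. An embedding of posets is a map $h$ such that $x\leq y$ if and only if $h(x)\leq h(y)$. *)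

(* Defs.v *)
(* Posets are given by a Prop-valued order on an arbitrary Type rather than by
   porderType, so that neither the order nor equality need be decidable. *)
From Stdlib Require Relation_Definitions.
From mathcomp Require Import all_boot.
From mathcomp Require Import classical_sets.

Set Implicit Arguments.
Unset Strict Implicit.
Unset Printing Implicit Defensive.

Local Open Scope classical_set_scope.

Record bounded_poset (P : Type) (le : P -> P -> Prop) (zero one : P) : Prop := {
  bp_order : Relation_Definitions.order P le;
  bp_le0 : forall x, le zero x;
  bp_le1 : forall x, le x one }.

Record bounded_comm_residuated_monoid (Q : Type) (le : Q -> Q -> Prop)
    (mul res : Q -> Q -> Q) (zero one : Q) : Prop := {
  bcrm_bounded : bounded_poset le zero one;
  bcrm_mulC : commutative mul;
  bcrm_mulA : associative mul;
  bcrm_mul1 : right_id one mul;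
  bcrm_adj : forall x y z, le (mul x y) z <-> le x (res y z) }.

Definition set_le (P : Type) (le : P -> P -> Prop) (A B : set P) : Prop :=
  forall x y, A x -> B y -> le x y.

Record operator_residuated_poset (P : Type) (le : P -> P -> Prop)
    (odot imp : P -> P -> set P) (zero one : P) : Prop := {
  orp_bounded : bounded_poset le zero one;
  orp_odotC : commutative odot;
  orp_odotA : forall x y z,
    \bigcup_(u in odot x y) odot u z = \bigcup_(u in odot y z) odot x u;
  orp_adj : forall x y z,
    set_le le (odot x y) [set z] <-> set_le le [set x] (imp y z) }.

Definition twist_le (Q : Type) (le : Q -> Q -> Prop) (p q : Q * Q) : Prop :=
  le p.1 q.1 /\ le q.2 p.2.

Definition twist_odot (Q : Type) (mul res : Q -> Q -> Q) (p q : Q * Q) :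
    set (Q * Q) :=
  [set (mul p.1 q.1, res p.1 q.2); (mul p.1 q.1, res q.1 p.2)].

Definition twist_imp (Q : Type) (mul res : Q -> Q -> Q) (p q : Q * Q) :
    set (Q * Q) :=
  [set (res p.1 q.1, mul p.1 q.2); (res q.2 p.2, mul p.1 q.2)].

Definition poset_embedding (P P' : Type) (le : P -> P -> Prop)
    (le' : P' -> P' -> Prop) (h : P -> P') : Prop :=
  forall x y, le x y <-> le' (h x) (h y).

(* Main.v *)
(* By currying, [(x * y) -> z = x -> (y -> z)], both iterated products of
   [(x, y)], [(z, v)] and [(s, t)] have first component [x * z * s], and their
   second components are the three elements [xz -> t], [xs -> v], [zs -> y].
   Both sides of the adjunction unfold to [xz <= s], [tx <= v] and [tz <= y]. *)
Require Import Defs.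
From mathcomp Require Import all_boot.
From mathcomp Require Import classical_sets.

Local Open Scope classical_set_scope.

Lemma set_le_pair1 (P : Type) (le : P -> P -> Prop) (a b z : P) :
  set_le le [set a; b] [set z] <-> le a z /\ le b z.
Proof.
split=> [h | [haz hbz] x y [->|->] -> //].
by split; apply: h => //; [left | right].
Qed.

Lemma set_le_1pair (P : Type) (le : P -> P -> Prop) (a b z : P) :
  set_le le [set z] [set a; b] <-> le z a /\ le z b.
Proof.
split=> [h | [hza hzb] x y -> [->|->] //].
by split; apply: h => //; [left | right].
Qed.

Lemma twist_bounded (Q : Type) (le : Q -> Q -> Prop) (zero one : Q) :
  bounded_poset le zero one ->
  bounded_poset (twist_le le) (zero, one) (one, zero).
Proof.
case=> -[refl trans anti] le0 le1; split=> [|p|p]; last 2 first.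
- by split; [exact: le0 | exact: le1].
- by split; [exact: le1 | exact: le0].
split=> [p | p q r [pq1 qp2] [qr1 rq2] | [x y] [z v] [/= xz vy] [/= zx yv]].
- by split; exact: refl.
- by split; [exact: trans pq1 qr1 | exact: trans rq2 qp2].
- by rewrite (anti _ _ xz zx) (anti _ _ vy yv).
Qed.

(** By adjunction and associativity both sides have the same lower bounds, the [w] with
    [w * x * y <= z]; antisymmetry then identifies them. *)
Lemma res_mul (Q : Type) (le : Q -> Q -> Prop) (mul res : Q -> Q -> Q)
    (zero one : Q) :
  bounded_comm_residuated_monoid le mul res zero one ->
  forall x y z, res (mul x y) z = res x (res y z).
Proof.
case=> -[[refl _ anti] _ _] _ mulA _ adj x y z.
have same w : le w (res (mul x y) z) <-> le w (res x (res y z)).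
  by rewrite -!adj mulA.
by apply: anti; apply/same; apply: refl.
Qed.

Theorem theorem4p2 (Q : Type) (le : Q -> Q -> Prop) (mul res : Q -> Q -> Q)
    (zero one : Q)
    (hQ : bounded_comm_residuated_monoid le mul res zero one) (a0 : Q) :
  operator_residuated_poset (twist_le le)
    (twist_odot mul res) (twist_imp mul res) (zero, one) (one, zero) /\
  poset_embedding le (twist_le le) (fun x : Q => (x, a0)).
Proof.
have curry := res_mul _ _ _ _ _ _ hQ.
case: hQ => bQ mulC mulA _ adj.
split; last first.
  move=> x y; split=> [xy | [] //].
  by split=> //=; case: bQ => -[].
split.
- exact: twist_bounded.
(* Swapping the factors exchanges the two elements of the product. *)
- by move=> p q; rewrite /twist_odot setUC (mulC p.1).
- move=> [x y] [z v] [s t].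
  rewrite !bigcup_setU !bigcup_set1 /twist_odot /= -!curry !mulA.
  rewrite (mulC s x) (mulC s z).
  (* Each side is a union of four singletons: the left repeats the one with [xz -> t], the right the
     one with [zs -> y]. Regrouping merges the duplicates. *)
  by rewrite setUACA setUid [RHS]setUACA setUid setUA.
- move=> [x y] [z v] [s t]; rewrite set_le_pair1 set_le_1pair /twist_le /=.
  have adjC a b c : le a (res b c) <-> le (mul b a) c by rewrite -adj mulC.
  rewrite !adjC (mulC z x) (mulC t x).
  (* Only multiplicities differ now: [xz <= s] occurs twice on the left, [zt <= y] twice on the
     right. *)
  by split=> [[[? ?] [? ?]] | [[? ?] [? ?]]].
Qed.
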